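(* For any $F$-subspace $A\subseteq B$, the polynomial relations of $A$ of weak $F$-Frobenius type, i.e. $\operatorname{pol}(A)\cap\Lambda$, form a free $K[\phi]$-module of rank at most $N$.
   Context: $F\subseteq K$ are fields, $F$ finite or infinite, $K$ algebraically closed; $q=|F|$ if $F$ is finite and $q=1$ if $F$ is infinite. $B$ is a finite dimensional $K$-algebra with $N=\dim_K B$ and a fixed $K$-base $b_1,\dots,b_N$; each $f\in K[\lambda_1,\dots,\lambda_N]$ is viewed as a function on $B$ by $f(\sum\alpha_ib_i)=f(\alpha_1,\dots,\alpha_N)$, and $\operatorname{pol}(A)=\{f: f(A)=0\}$. $\Lambda\subset K[\lambda_1,\dots,\lambda_N]$ denotes the set of all polynomials of weak $F$-Frobenius type ($q$-polynomials), i.e. finite sums $\sum_{i}\sum_{j} c_{ij}\lambda_i^{q_{ij}}$ with $c_{ij}\in K$ and each $q_{ij}$ a power of $q$ (including $q^0=1$). Let $\phi$ be the map $f\mapsto f^{q}$, so $\phi\cdot a=a^q$ for $a\in K$ and $\phi\cdot\lambda_i=\lambda_i^q$. $K[\phi]$ denotes the ring of operators on $\Lambda$ generated by multiplications by elements of $K$ and $\phi$ (so $\phi a=a^q\phi$ for $a \in K$; if $F$ is infinite then $\phi$ is the identity and $K[\phi]=K$), and $\Lambda$ is a left $K[\phi]$-module, free on $\lambda_1,\dots,\lambda_N$. *)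

(* Defs.v *)
(* MathComp, with the classical sets of MathComp-Analysis and multinomials. *)
From mathcomp Require Export all_boot all_algebra.
From mathcomp Require Export finmap boolp classical_sets cardinality.
From mathcomp Require Export mpoly.

Set Implicit Arguments.
Unset Strict Implicit.
Unset Printing Implicit Defensive.

Import GRing.Theory.

Local Open Scope ring_scope.
Local Open Scope classical_set_scope.

Definition frob_q (F : fieldType) : nat :=
  if pselect (finite_set [set: F]) then #|` fset_set [set: F]|%fset else 1%N.

Definition is_F_subspace (F : fieldType) (K : fieldType)
    (iota : {rmorphism F -> K}) (B : lmodType K) (A : set B) : Prop :=
  [/\ A 0,
      forall x y, A x -> A y -> A (x + y) &
      forall (c : F) x, A x -> A (iota c *: x)].

Definition poly_fun (K : fieldType) (B : vectType K) (N : nat)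
    (b : N.-tuple B) (f : {mpoly K[N]}) (x : B) : K :=
  f.@[fun i => coord b i x].

Definition pol (K : fieldType) (B : vectType K) (N : nat)
    (b : N.-tuple B) (A : set B) : set {mpoly K[N]} :=
  [set f | forall x, A x -> poly_fun b f x = 0].

(* A common number m of summands for all the variables is no restriction,
   since the coefficients may vanish. *)
Definition Lambda (K : fieldType) (N q : nat) : set {mpoly K[N]} :=
  [set f | exists (m : nat) (c : 'I_N -> 'I_m -> K) (e : 'I_N -> 'I_m -> nat),
     f = \sum_(i < N) \sum_(j < m) c i j *: 'X_i ^+ (q ^ e i j)].

(* Representatives of the elements of K[phi]: these are operators on Lambda,
   so two of them are the same element when they agree on Lambda. *)
Inductive Kphi (K : fieldType) (N q : nat) :
    ({mpoly K[N]} -> {mpoly K[N]}) -> Prop :=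
| Kphi_scale (a : K) : Kphi q (fun f => a *: f)
| Kphi_phi : Kphi q (fun f => f ^+ q)
| Kphi_add S T : Kphi q S -> Kphi q T -> Kphi q (fun f => S f + T f)
| Kphi_opp S : Kphi q S -> Kphi q (fun f => - S f)
| Kphi_comp S T : Kphi q S -> Kphi q T -> Kphi q (fun f => S (T f)).

Definition Kphi_submodule (K : fieldType) (N q : nat)
    (M : set {mpoly K[N]}) : Prop :=
  [/\ M `<=` Lambda q,
      M 0,
      forall f g, M f -> M g -> M (f + g) &
      forall T f, Kphi q T -> M f -> M (T f)].

Definition Kphi_basis (K : fieldType) (N q : nat) (M : set {mpoly K[N]})
    (r : nat) (g : 'I_r -> {mpoly K[N]}) : Prop :=
  [/\ forall j, M (g j),
      forall f, M f -> exists T : 'I_r -> {mpoly K[N]} -> {mpoly K[N]},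
        (forall j, Kphi q (T j)) /\ f = \sum_(j < r) T j (g j) &
      forall T : 'I_r -> {mpoly K[N]} -> {mpoly K[N]},
        (forall j, Kphi q (T j)) -> \sum_(j < r) T j (g j) = 0 ->
        forall j f, Lambda q f -> T j f = 0].

Definition Kphi_free_of_rank (K : fieldType) (N q : nat)
    (M : set {mpoly K[N]}) (r : nat) : Prop :=
  Kphi_submodule q M /\ exists g : 'I_r -> {mpoly K[N]}, Kphi_basis q M g.

(* Main.v *)
From HB Require Import structures.
Require Import Defs.
From mathcomp Require Import all_solvable all_field.
Import GRing.Theory.

(** The ring K[phi] behaves like a skew polynomial ring: it has a one-sided
    division algorithm, so its left ideals are principal, and a submodule of a
    free left module of rank N over such a ring is free of rank at most N.  The
    proof runs this classical argument directly on q-polynomials, so that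
    the two cases q = 1 and q > 1
    (where phi is the identity, respectively transcendental) are treated at
    once.

    The i-th coordinate of f in Lambda is the univariate q-polynomial obtained
    by sending 'X_i to 'X and the other variables to 0 ([component]); a
    member of Lambda is determined by its coordinates ([Lambda_eq0]).  An
    operator T of K[phi] acts on every coordinate as the composition t \Po _
    with a single univariate polynomial t ([Kphi_comp_poly]).  Hence K[phi] has
    no zero divisors: a nonzero q-polynomial p has no constant term, so it is
    not constant and t \Po p = 0 forces t = 0 ([qpoly_eq0_comp]).

    Degrees of q-polynomials are powers of q, so the leading term of a
    q-polynomial p is killed by subtracting c *: p0 ^+ (q ^ n) as soon as the
    degree of p0 does not exceed that of p ([qpoly_division_step]).
    Consequently, in a submodule M, an f0 whose k-th coordinate is nonzero of
    least degree generates the k-th coordinates of all of M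
    ([submodule_division]).  Adding f0 to a basis of the submodule where the
    k-th coordinate vanishes gives a basis of M; induction on the number of
    coordinates concludes ([Kphi_free_bounded]).

    That Lambda is stable under phi relies on the additivity of x |-> x ^+ q,
    which holds because q is 1 or the order of a finite subfield of K
    ([pchar_nat_frob_q]).  That pol b A is stable under K[phi] holds because
    the operators commute with evaluation and fix 0. *)

Local Open Scope ring_scope.
Local Open Scope classical_set_scope.

(** * The Frobenius exponent *)

(** If F is finite, its additive group is an elementary abelian p-group for p
    its characteristic, hence its order is a power of p. *)
Lemma pchar_nat_frob_q (F K : fieldType) (iota : {rmorphism F -> K}) :
  [pchar K].-nat (frob_q F).
Proof.
rewrite /frob_q; case: pselect => // finF.
(* A finite field structure on F itself, from the finiteness of its underlying
   set. *)
pose e : seq F := enum_fset (fset_set [set: F]).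
have enumP : Finite.axiom e.
  move=> x; rewrite count_uniq_mem ?fset_uniq //.
  by rewrite /e in_fset_set // in_setT.
have indexK : pcancel (index^~ e) (fun i => Some e`_i).
  by move=> x; rewrite nth_index // /e in_fset_set // in_setT.
pose cF := PCanIsCountable indexK.
pose CF : countType := HB.pack F cF.
pose fF : isFinite CF := isFinite.Build CF enumP.
pose FF : finFieldType := HB.pack F cF fF.
have [p _ pF] := finPcharP FF.
have := abelem_pgroup (fin_ring_pchar_abelem pF).
have cardFF : #|FF| = size e.
  rewrite cardE; apply: perm_size; apply: uniq_perm => [||x].
  - exact: enum_uniq.
  - exact: fset_uniq.
  by rewrite mem_enum /e in_fset_set // in_setT.
rewrite /pgroup cardsT cardFF /=; apply: sub_in_pnat => r _ /eqP ->.
exact: (rmorph_pchar iota pF).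
Qed.

(** * Coordinates of multivariate q-polynomials *)

(** The index k is a natural number rather than an ordinal: this lets the main
    induction run over the number of coordinates with N fixed. *)
Definition component (K : fieldType) (N k : nat) : {mpoly K[N]} -> {poly K} :=
  mmap polyC (fun i : 'I_N => if i == k :> nat then 'X else 0).

HB.instance Definition _ (K : fieldType) (N k : nat) :=
  GRing.RMorphism.copy (@component K N k)
    (mmap polyC (fun i : 'I_N => if i == k :> nat then 'X else 0)).

Arguments component {K N}.

Section Components.

Set Implicit Arguments.
Unset Strict Implicit.

Variables (K : fieldType) (N q : nat).
Implicit Types (f g : {mpoly K[N]}) (p : {poly K}) (k : nat).

Lemma componentZ k c f : component k (c *: f) = c *: component k f.
Proof. by rewrite /component mmapZ mul_polyC. Qed.

Lemma componentX k (i : 'I_N) :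
  component k 'X_i = if i == k :> nat then 'X else 0 :> {poly K}.
Proof. by rewrite /component mmapX mmap1U. Qed.

(** The support condition, instead of an explicit sum, gives access to the
    degree at once. *)
Definition qpoly p := forall j, p`_j != 0 -> exists e, j = (q ^ e)%N.

Hypothesis qchar : [pchar K].-nat q.

Let q_gt0 : (0 < q)%N. Proof. by case/andP: qchar. Qed.

Let expr0q (R : pzSemiRingType) : 0 ^+ q = 0 :> R.
Proof. by rewrite expr0n gtn_eqF. Qed.

Lemma component_term k (i : 'I_N) (c : K) e :
  component k (c *: 'X_i ^+ (q ^ e)) =
    if i == k :> nat then c *: 'X^(q ^ e) else 0.
Proof.
rewrite componentZ rmorphXn /= componentX; case: ifP => // _.
by rewrite expr0n expn_eq0 gtn_eqF // scaler0.
Qed.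

Lemma qpolyD p r : qpoly p -> qpoly r -> qpoly (p + r).
Proof.
move=> qp qr j; have [p0|/qp//] := eqVneq p`_j 0.
by rewrite coefD p0 add0r; exact: qr.
Qed.

Lemma qpoly0 : qpoly 0.
Proof. by move=> j; rewrite coef0 eqxx. Qed.

Lemma qpoly_monomial c e : qpoly (c *: 'X^(q ^ e)).
Proof.
move=> j; rewrite coefZ coefXn; case: (j =P _) => [-> _|_]; first by exists e.
by rewrite mulr0 eqxx.
Qed.

Lemma component_qpoly k f : Lambda q f -> qpoly (component k f).
Proof.
case=> m [c [e ->]]; rewrite rmorph_sum.
apply: big_ind => [||i _]; [exact: qpoly0 | exact: qpolyD |].
rewrite /= rmorph_sum.
apply: big_ind => [||j _]; [exact: qpoly0 | exact: qpolyD |].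
rewrite /= component_term; case: ifP => _; last exact: qpoly0.
exact: qpoly_monomial.
Qed.

(** Lambda is the direct sum of the q-polynomials in each single variable:
    substituting 'X_i back into the i-th coordinate and summing recovers f. *)
Lemma Lambda_decomp f : Lambda q f ->
  f = \sum_(i < N) horner_alg 'X_i (component i f).
Proof.
case=> m [c [e ->]]; apply: eq_bigr => i _.
have -> : component i
      (\sum_(i' < N) \sum_(j < m) c i' j *: 'X_i' ^+ (q ^ e i' j))
    = \sum_(j < m) c i j *: 'X^(q ^ e i j).
  rewrite (rmorph_sum (component i)) (bigD1 i) //= [X in _ + X]big1 ?addr0.
    rewrite (rmorph_sum (component i)); apply: eq_bigr => j _.
    by rewrite /= component_term eqxx.
  move=> i' ne; rewrite (rmorph_sum (component i)); apply: big1 => j _.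
  by rewrite /= component_term ifN.
rewrite rmorph_sum; apply: eq_bigr => l _.
by rewrite /= linearZ /= rmorphXn /= horner_algX mulr_algl.
Qed.

Lemma Lambda_eq0 f :
  Lambda q f -> (forall i : 'I_N, component i f = 0) -> f = 0.
Proof.
move=> Lf H; rewrite [LHS](Lambda_decomp Lf) big1 // => i _.
by rewrite H rmorph0.
Qed.

(** * Lambda as a module over K[phi] *)

Lemma Lambda0 : Lambda q (0 : {mpoly K[N]}).
Proof.
exists 0, (fun _ _ => 0), (fun _ _ => 0).
by rewrite big1 // => i _; rewrite big_ord0.
Qed.

Lemma LambdaD f g : Lambda q f -> Lambda q g -> Lambda q (f + g).
Proof.
case=> m [c [e ->]] [m' [c' [e' ->]]]; exists (m + m')%N.
exists (fun i j => match split j with inl j => c i j | inr j => c' i j end).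
exists (fun i j => match split j with inl j => e i j | inr j => e' i j end).
rewrite -big_split /=; apply: eq_bigr => i _; rewrite big_split_ord /=.
congr (_ + _); apply: eq_bigr => j _.
  by rewrite (unsplitK (inl j)).
by rewrite (unsplitK (inr j)).
Qed.

(** The morphism h transports the characteristic of K to R. *)
Lemma frob_sum (R : comNzRingType) (I : finType) (h : {rmorphism K -> R})
  (P : I -> R) : (\sum_i P i) ^+ q = \sum_i P i ^+ q.
Proof.
have qR : [pchar R].-nat q.
  by apply: sub_in_pnat qchar => p _; exact: (rmorph_pchar h).
elim/big_rec2: _ => [|i x y _ <-]; last exact: exprDn_pchar.
by rewrite expr0q.
Qed.

Lemma Lambda_frob f : Lambda q f -> Lambda q (f ^+ q).
Proof.
case=> m [c [e ->]].
exists m, (fun i j => c i j ^+ q), (fun i j => (e i j).+1).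
pose h : {rmorphism K -> {mpoly K[N]}} := @mpolyC N K.
rewrite (frob_sum h); apply: eq_bigr => i _.
rewrite (frob_sum h); apply: eq_bigr => j _.
by rewrite exprZn -exprM expnSr.
Qed.

Lemma LambdaZ c f : Lambda q f -> Lambda q (c *: f).
Proof.
case=> m [d [e ->]]; exists m, (fun i j => c * d i j), e.
rewrite scaler_sumr; apply: eq_bigr => i _.
by rewrite scaler_sumr; apply: eq_bigr => j _; rewrite scalerA.
Qed.

Lemma Lambda_Kphi T f : Kphi q T -> Lambda q f -> Lambda q (T f).
Proof.
move=> KT; elim: KT f => {T} [a||S T _ IS _ IT|S _ IS|S T _ IS _ IT] f Lf.
- exact: LambdaZ.
- exact: Lambda_frob.
- by apply: LambdaD; [exact: IS | exact: IT].
- by rewrite -scaleN1r; apply: LambdaZ; exact: IS.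
- exact/IS/IT.
Qed.

(** Composition turns the operators, which are only known as functions, into
    polynomials: t is the value of T at a single variable, and t.[0] = 0 gives
    t \Po 0 = 0, so that vanishing coordinates stay zero.  The same t
    serves for all f and k, which makes independence of a family of generators
    testable on one coordinate. *)
Lemma Kphi_comp_poly T : Kphi q T -> exists2 t : {poly K}, t.[0] = 0 &
  forall f k, component k (T f) = t \Po component k f.
Proof.
elim=> {T} [a||S T _ [s s0 IS] _ [t t0 IT]|S _ [s s0 IS]
           |S T _ [s s0 IS] _ [t t0 IT]].
- exists (a *: 'X) => [|f k]; first by rewrite hornerZ hornerX mulr0.
  by rewrite comp_polyZ comp_polyX componentZ.
- exists 'X^q => [|f k]; first by rewrite hornerXn expr0q.
  by rewrite comp_Xn_poly rmorphXn.
- exists (s + t) => [|f k]; first by rewrite hornerD s0 t0 addr0.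
  by rewrite comp_polyD rmorphD /= IS IT.
- exists (- s) => [|f k]; first by rewrite hornerN s0 oppr0.
  by rewrite raddfN rmorphN /= IS.
- exists (s \Po t) => [|f k]; first by rewrite horner_comp t0 s0.
  by rewrite IS IT comp_polyA.
Qed.

Lemma Kphi_frob_exp (a : K) n :
  Kphi q (fun f : {mpoly K[N]} => a *: f ^+ (q ^ n)).
Proof.
have frobn : Kphi q (fun f : {mpoly K[N]} => f ^+ (q ^ n)).
  elim: n => [|n IH].
    have -> : (fun f : {mpoly K[N]} => f ^+ (q ^ 0)) = (fun f => 1 *: f).
      by apply: funext => f; rewrite scale1r.
    exact: Kphi_scale.
  have -> : (fun f : {mpoly K[N]} => f ^+ (q ^ n.+1))
          = (fun f => (f ^+ (q ^ n)) ^+ q).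
    by apply: funext => f; rewrite -exprM expnSr.
  exact: (Kphi_comp (Kphi_phi _ _ _) IH).
exact: (Kphi_comp (Kphi_scale _ _ a) frobn).
Qed.

(** * The division algorithm *)

Lemma qpoly_size p : qpoly p -> p != 0 -> exists e, size p = (q ^ e).+1.
Proof.
move=> qp p0; have [|e he] := qp (size p).-1.
  by rewrite -lead_coefE lead_coef_eq0.
by exists e; rewrite -he prednK // size_poly_gt0.
Qed.

(** K[phi] acts without torsion: q ^ e > 0, so p is not constant and
    composition with it is injective. *)
Lemma qpoly_eq0_comp p (t : {poly K}) :
  qpoly p -> p != 0 -> t \Po p = 0 -> t = 0.
Proof.
move=> qp p0; have [e szp] := qpoly_size qp p0.
by move/eqP; rewrite comp_poly_eq0 ?szp ?ltnS ?expn_gt0 ?q_gt0 // => /eqP.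
Qed.

(** The degrees are q ^ n <= q ^ m, and raising p0 to the power q ^ (m - n)
    brings its degree up to that of p. *)
Lemma qpoly_division_step (p p0 : {poly K}) :
  qpoly p -> qpoly p0 -> p0 != 0 -> (size p0 <= size p)%N ->
  exists c n, (size (p - c *: p0 ^+ (q ^ n))%R < size p)%N.
Proof.
move=> qp qp0 nz0 le0.
have nz : p != 0 by rewrite -size_poly_gt0 (leq_trans _ le0) // size_poly_gt0.
have [m szp] := qpoly_size qp nz; have [n szp0] := qpoly_size qp0 nz0.
have emn : (q ^ n * q ^ (m - n) = q ^ m)%N.
  rewrite -expnD; have [/subnKC -> //|ltmn] := leqP n m.
  (* For q > 1 this cannot happen; for q = 1 both powers are 1 and the truncated
     difference m - n = 0 is the right exponent. *)
  move: le0; rewrite szp szp0 ltnS => le0.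
  have -> : (m - n = 0)%N by apply/eqP; rewrite subn_eq0 ltnW.
  by rewrite addn0; apply/eqP; rewrite eqn_leq le0 leq_pexp2l // ltnW.
set r := p0 ^+ (q ^ (m - n)).
have rnz : r != 0 by rewrite expf_neq0.
have szr : size r = size p.
  rewrite -[LHS]prednK ?size_poly_gt0 // size_exp szp0 /=.
  by rewrite emn szp.
have lr : lead_coef r != 0 by rewrite lead_coef_eq0.
exists (lead_coef p / lead_coef r), (m - n)%N.
rewrite -/r szp ltnS; apply/leq_sizeP => j.
rewrite leq_eqVlt => /predU1P[<-|ltj].
  rewrite coefB coefZ.
  have -> : r`_(q ^ m) = lead_coef r by rewrite lead_coefE szr szp.
  by rewrite divfK // lead_coefE szp subrr.
rewrite coefB coefZ !nth_default ?mulr0 ?subrr //; last by rewrite szp.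
by rewrite szr szp.
Qed.

Lemma submoduleB (M : set {mpoly K[N]}) f g :
  Kphi_submodule q M -> M f -> M g -> M (f - g).
Proof.
move=> [_ _ MD MK] Mf Mg; apply: MD => //.
rewrite -scaleN1r; exact: MK (Kphi_scale _ _ _) Mg.
Qed.

(** Principality of the left ideal formed by the k-th coordinates of M.  The
    remainder of a division by f0 stays in M, so by minimality of f0 it can be
    divided again until its k-th coordinate vanishes. *)
Lemma submodule_division (M : set {mpoly K[N]}) k f0 :
    Kphi_submodule q M -> M f0 -> component k f0 != 0 ->
    (forall f, M f -> component k f != 0 ->
       (size (component k f0) <= size (component k f))%N) ->
  forall f, M f -> exists2 T, Kphi q T & component k (f - T f0) = 0.
Proof.
move=> sM Mf0 nz0 minf0 f Mf; case: (sM) => ML _ _ MK.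
have [n] := ubnP (size (component k f)); elim: n f Mf => // n IH f Mf ltn.
have [fz|nz] := eqVneq (component k f) 0.
  exists (fun f => 0 *: f); first exact: Kphi_scale.
  by rewrite scale0r subr0.
have [c [e lt1]] := qpoly_division_step (component_qpoly (ML _ Mf))
  (component_qpoly (ML _ Mf0)) nz0 (minf0 _ Mf nz).
have KT := Kphi_frob_exp c e.
have [||S KS S0] := IH (f - c *: f0 ^+ (q ^ e)).
- by apply: (submoduleB sM) => //; exact: MK KT Mf0.
- rewrite rmorphB /= componentZ rmorphXn /=; exact: leq_trans lt1 _.
exists (fun f => c *: f ^+ (q ^ e) + S f); first exact: Kphi_add.
by rewrite opprD addrA.
Qed.

(** * Freeness of submodules *)

(** The exact sequence 0 -> M' -> M -> I -> 0, where I is the left ideal of k-th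
    coordinates and M' is the kernel, splits because I is either 0 or free on
    one generator: each induction step adds at most one basis element. *)
Lemma Kphi_free_bounded k (M : set {mpoly K[N]}) :
    Kphi_submodule q M ->
    (forall f i, M f -> (k <= i)%N -> component i f = 0) ->
  exists2 r, (r <= k)%N & Kphi_free_of_rank q M r.
Proof.
elim: k M => [|k IH] M sM Mcomp.
  exists 0 => //; split=> //; exists (fun _ => 0); case: sM => ML M0 MD MK.
  split=> [[]//|f Mf|T _ _ []//]; exists (fun _ => id); split=> [[]//|].
  rewrite big_ord0; apply: Lambda_eq0; first exact: ML.
  by move=> i; apply: Mcomp.
case: (sM) => ML M0 MD MK.
pose M' := M `&` [set f | component k f = 0].
have sM' : Kphi_submodule q M'.
  split=> [f [/ML]//||f g [Mf f0] [Mg g0]|T f KT [Mf f0]].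
  - by split=> //=; rewrite rmorph0.
  - by split=> /=; [exact: MD | rewrite rmorphD /= f0 g0 addr0].
  split=> /=; first exact: MK.
  have [t t0 ->] := Kphi_comp_poly KT.
  by rewrite f0 comp_poly0r -horner_coef0 t0.
have [|r ler [_ [g [gM gspan gfree]]]] := IH M' sM'.
  move=> f i [Mf f0]; rewrite leq_eqVlt => /predU1P[<- //|]; exact: Mcomp.
have [MM'|/existsNP[f1 /not_implyP[Mf1 nz1]]] :=
    pselect (forall f, M f -> component k f = 0).
  have eqM : M = M'.
    by apply/seteqP; split=> f; [move=> Mf; split=> //; exact: MM' | case].
  by exists r; [exact: leqW | rewrite eqM; split=> //; exists g].
pose P n := `[< exists f,
  [/\ M f, component k f != 0 & size (component k f) = n] >].
have exP : exists n, P n.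
  exists (size (component k f1)); apply/asboolP.
  by exists f1; split=> //; exact/eqP.
case: (ex_minnP exP) => n /asboolP[f0 [Mf0 nz0 szn]] minn.
have minf0 f : M f -> component k f != 0 ->
    (size (component k f0) <= size (component k f))%N.
  by move=> Mf nz; rewrite szn; apply: minn; apply/asboolP; exists f.
exists r.+1 => //; split=> //.
exists (fun j => oapp g f0 (unlift ord0 j)); split.
- by move=> j; case: unliftP => [i _|_] //=; case: (gM i).
- move=> f Mf; have [T KT T0] := submodule_division sM Mf0 nz0 minf0 Mf.
  have [|S [KS eS]] := gspan (f - T f0).
    by split=> //; apply: (submoduleB sM) => //; exact: MK.
  exists (fun j => oapp S T (unlift ord0 j)); split.
    by move=> j; case: unliftP => [i _|_] /=; [exact: KS | exact: KT].
  rewrite big_ord_recl unlift_none /=.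
  under eq_bigr do rewrite liftK /=.
  by rewrite -eS addrC subrK.
move=> T KT; rewrite big_ord_recl unlift_none /=.
under eq_bigr do rewrite liftK /=.
move=> sum0.
(* The k-th coordinate of the relation only involves f0, so the coefficient of
   f0 vanishes and what remains is a relation between the g i. *)
have T0 f : Lambda q f -> T ord0 f = 0.
  have [t t0 Tt] := Kphi_comp_poly (KT ord0).
  have tz : t = 0.
    apply: (qpoly_eq0_comp (component_qpoly (ML _ Mf0)) nz0).
    have := congr1 (component k) sum0.
    rewrite rmorph0 rmorphD rmorph_sum /= Tt.
    rewrite big1 ?addr0 // => j _.
    have [s s0 ->] := Kphi_comp_poly (KT (lift ord0 j)).
    have [_ /= ->] := gM j.
    by rewrite comp_poly0r -horner_coef0 s0.
  move=> Lf; apply: Lambda_eq0; first exact: Lambda_Kphi.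
  by move=> i; rewrite Tt tz comp_poly0.
move=> j f Lf; case: (unliftP ord0 j) => [i ->|->]; last exact: T0.
apply: (gfree (fun i => T (lift ord0 i))) => //.
by rewrite -[RHS]sum0 T0 ?add0r //; exact: ML.
Qed.

Lemma component_ge k f : (N <= k)%N -> Lambda q f -> component k f = 0.
Proof.
move=> leNk [m [c [e ->]]]; rewrite rmorph_sum; apply: big1 => i _.
rewrite /= rmorph_sum; apply: big1 => j _; rewrite /= component_term ifN //.
by rewrite neq_ltn (leq_trans (ltn_ord i) leNk).
Qed.

Lemma Kphi_submodule_free (M : set {mpoly K[N]}) : Kphi_submodule q M ->
  exists2 r, (r <= N)%N & Kphi_free_of_rank q M r.
Proof.
move=> sM; apply: Kphi_free_bounded => // f i Mf leNi.
by apply: component_ge => //; case: sM => ML _ _ _; exact: ML.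
Qed.

Lemma pol_Lambda_submodule (B : vectType K) (b : N.-tuple B) (A : set B) :
  Kphi_submodule q (pol b A `&` Lambda q).
Proof.
split=> [f []//||f g [pf Lf] [pg Lg]|T f KT [pf Lf]].
- by split; [move=> x _; exact: meval0 | exact: Lambda0].
- split; last exact: LambdaD.
  move=> x Ax.
  by rewrite /poly_fun mevalD [X in X + _]pf // [X in _ + X]pg // addr0.
split; last exact: Lambda_Kphi.
elim: KT f pf {Lf} => {T} [a||S T _ IS _ IT|S _ IS|S T _ IS _ IT] f pf x Ax;
  rewrite /poly_fun.
- by rewrite mevalZ [X in _ * X]pf // mulr0.
- by rewrite rmorphXn /= [X in X ^+ _]pf // expr0q.
- by rewrite mevalD [X in X + _]IS // [X in _ + X]IT // addr0.
- by rewrite mevalN [X in - X]IS // oppr0.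
- exact: IS (IT _ pf) _ Ax.
Qed.

End Components.

Theorem theorem6p2 (F : fieldType) (K : closedFieldType)
    (iota : {rmorphism F -> K})
    (B : vectType K) (mul : {bilinear B -> B -> B})
    (N : nat) (dimB : \dim {:B} = N)
    (b : N.-tuple B) (b_basis : basis_of {:B} b)
    (A : set B) (A_sub : is_F_subspace iota A) :
  exists r : nat, (r <= N)%N /\
    Kphi_free_of_rank (frob_q F) (pol b A `&` Lambda (frob_q F)) r.
Proof.
have qchar := pchar_nat_frob_q F K iota.
have [r ler Mr] := Kphi_submodule_free qchar (pol_Lambda_submodule qchar b A).
by exists r.
Qed.
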